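(* Let $n\ge 3$ and $A\in\mathbb{R}^{n\times n}$. Let $G_2(A)$ be the graph with vertex set $\{1,\dots,n\}$ whose edges are the rich pair supports of $A$. Then $G_2(A)$ is triangle-free.
   Context: Vector inequalities are componentwise ($u>0$ means all components are positive). For $A\in\mathbb{R}^{n\times n}$, a support is a nonempty subset $J\subseteq\{1,\dots,n\}$, with complement $J^{\mathrm c}$; $A_J$ is the principal submatrix indexed by $J$ and $A_{J^{\mathrm c},J}$ is the submatrix with rows in $J^{\mathrm c}$ and columns in $J$. The support $J$ produces $\lambda\in\mathbb{R}$ if there is $u\in\mathbb{R}^{|J|}$ with $A_Ju=\lambda u$, $u>0$, $A_{J^{\mathrm c},J}u\ge 0$. A pair support is a support with two elements. A pair support is rich if it produces two distinct values. *)

(* Defs.v *)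
From mathcomp Require Import all_boot all_order all_algebra.
From mathcomp Require Import reals.

Set Implicit Arguments.
Unset Strict Implicit.
Unset Printing Implicit Defensive.

Import Order.TTheory GRing.Theory Num.Theory.
Local Open Scope ring_scope.

(* Rows in I and columns in J, both listed in increasing order. *)
Definition set_submx (R : realType) (n : nat) (A : 'M[R]_n)
    (I J : {set 'I_n}) : 'M[R]_(#|I|, #|J|) :=
  mxsub (fun i : 'I_#|I| => enum_val i) (fun j : 'I_#|J| => enum_val j) A.

Definition is_support (n : nat) (J : {set 'I_n}) : Prop := J != set0.

Definition produces (R : realType) (n : nat) (A : 'M[R]_n)
    (J : {set 'I_n}) (lam : R) : Prop :=
  is_support J /\
  exists u : 'cV[R]_#|J|,
    [/\ set_submx A J J *m u = lam *: u,
        forall i, 0 < u i 0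
      & forall k, 0 <= (set_submx A (~: J) J *m u) k 0].

Definition pair_support (n : nat) (J : {set 'I_n}) : Prop :=
  is_support J /\ #|J| = 2%N.

Definition rich (R : realType) (n : nat) (A : 'M[R]_n)
    (J : {set 'I_n}) : Prop :=
  exists lam mu : R, [/\ lam != mu, produces A J lam & produces A J mu].

(* The edge predicate is Prop-valued because richness quantifies over the reals. *)
Record graph (V : finType) := Graph {
  edge : {set V} -> Prop;
  card_edge : forall e, edge e -> #|e| = 2%N
}.

Definition triangle_free (V : finType) (G : graph V) : Prop :=
  ~ exists x y z : V,
      [/\ x != y, y != z & x != z] /\
      [/\ edge G [set x; y], edge G [set y; z] & edge G [set x; z]].

Definition rich_pair_support (R : realType) (n : nat) (A : 'M[R]_n)
    (J : {set 'I_n}) : Prop :=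
  pair_support J /\ rich A J.

Lemma card_rich_pair_support (R : realType) (n : nat) (A : 'M[R]_n)
    (J : {set 'I_n}) : rich_pair_support A J -> #|J| = 2%N.
Proof. by case=> -[]. Qed.

Definition G2 (R : realType) (n : nat) (A : 'M[R]_n) : graph 'I_n :=
  Graph (@card_rich_pair_support R n A).

(* Main.v *)
Require Import Defs.
From mathcomp Require Import all_boot all_order all_algebra.
From mathcomp Require Import reals.
From mathcomp Require Import ring lra.

(** The ratio [t = u_j / u_i] of a positive eigenvector on the pair [{i, j}] is
a root of [a_ij t^2 + (a_ii - a_jj) t - a_ji].  If the pair is rich, this
polynomial has two distinct positive roots, so [a_jj - a_ii] has the sign of
[a_ij] and [a_ji] the opposite sign: in the row of the larger diagonal entry the
off-diagonal entry is negative.  In a triangle of rich pairs, the row [k] of the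
largest diagonal entry thus has [a_ki < 0] and [a_kj < 0], which contradicts
[a_ki u_i + a_kj u_j >= 0] for the pair [{i, j}]. *)

Set Implicit Arguments.
Unset Strict Implicit.
Unset Printing Implicit Defensive.

Import Order.TTheory GRing.Theory Num.Theory.
Local Open Scope ring_scope.

(** Reindexing: a function on all of ['I_n] replaces the vector indexed by ['I_#|J|], so later sums
    run over [J] itself. *)
Lemma produces_extension (R : realType) (n : nat) (A : 'M[R]_n)
    (J : {set 'I_n}) (lam : R) :
  produces A J lam ->
  exists f : 'I_n -> R,
    [/\ forall i, i \in J -> 0 < f i,
        forall i, i \in J -> \sum_(j in J) A i j * f j = lam * f i
      & forall k, k \notin J -> 0 <= \sum_(j in J) A k j * f j].
Proof.
case=> /set0Pn [x0 x0J] [u [eig_u u_gt0 nneg_u]].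
(* Outside [J] this is a default entry of [u]; the sums over [J] never see it. *)
pose f i := u (enum_rank_in x0J i) 0.
have sumE (I : {set 'I_n}) (i : 'I_#|I|) :
    (set_submx A I J *m u) i 0 = \sum_(j in J) A (enum_val i) j * f j.
  by rewrite mxE [RHS]big_enum_val; apply: eq_bigr => j _;
    rewrite mxE /f enum_valK_in.
exists f; split=> [i _ | i iJ | k]; first exact: u_gt0.
- move: (congr1 (fun v : 'cV_#|J| => v (enum_rank_in x0J i) 0) eig_u).
  by rewrite sumE mxE enum_rankK_in.
rewrite -in_setC => kJ.
by move: (nneg_u (enum_rank_in kJ k)); rewrite sumE enum_rankK_in.
Qed.

Lemma produces_pair (R : realType) (n : nat) (A : 'M[R]_n) (x y : 'I_n)
    (lam : R) :
  x != y -> produces A [set x; y] lam ->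
  exists a b : R,
    [/\ 0 < a /\ 0 < b,
        A x x * a + A x y * b = lam * a,
        A y x * a + A y y * b = lam * b
      & forall k, k != x -> k != y -> 0 <= A k x * a + A k y * b].
Proof.
move=> xy /produces_extension [f [f_gt0 eig_f nneg_f]].
have sumE i : \sum_(j in [set x; y]) A i j * f j = A i x * f x + A i y * f y.
  by rewrite big_setU1 ?inE //= big_set1.
exists (f x), (f y); split.
- by split; apply: f_gt0; rewrite !inE eqxx ?orbT.
- by rewrite -sumE eig_f // !inE eqxx.
- by rewrite -sumE eig_f // !inE eqxx orbT.
by move=> k kx ky; rewrite -sumE nneg_f // !inE negb_or kx.
Qed.

Lemma rich_pair_sign (R : realType) (n : nat) (A : 'M[R]_n) (x y : 'I_n) :
  x != y -> rich A [set x; y] ->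
  (A x x < A y y /\ A y x < 0) \/ (A y y < A x x /\ A x y < 0).
Proof.
move=> xy [lam [mu [lam_mu]]].
move=> /(produces_pair xy) [a [b [[a0 b0] lam_x lam_y _]]].
move=> /(produces_pair xy) [c [d [[c0 d0] mu_x mu_y _]]].
pose t := b / a; pose s := d / c.
have t0 : 0 < t by rewrite divr_gt0.
have s0 : 0 < s by rewrite divr_gt0.
have bE : b = t * a by rewrite divfK ?gt_eqF.
have dE : d = s * c by rewrite divfK ?gt_eqF.
have lamE : lam = A x x + A x y * t.
  by apply: (mulIf (lt0r_neq0 a0)); rewrite -lam_x bE; ring.
have muE : mu = A x x + A x y * s.
  by apply: (mulIf (lt0r_neq0 c0)); rewrite -mu_x dE; ring.
have t_root : A y x + A y y * t = lam * t.
  by apply: (mulIf (lt0r_neq0 a0)); rewrite -mulrA -bE -lam_y bE; ring.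
have s_root : A y x + A y y * s = mu * s.
  by apply: (mulIf (lt0r_neq0 c0)); rewrite -mulrA -dE -mu_y dE; ring.
(* By row [x], the ratio determines the produced value. *)
have ts : t - s != 0.
  apply: contraNneq lam_mu => /eqP; rewrite subr_eq0 => /eqP ts.
  by rewrite lamE muE ts.
(* Vieta's formulas for the roots t and s. *)
have sum_ts : A y y - A x x = A x y * (t + s).
  (* Subtracting the two root equations leaves a multiple of [t - s]. *)
  apply: (mulIf ts).
  move: t_root s_root; rewrite lamE muE => t_root s_root; nra.
have prod_ts : A y x = - (A x y * (t * s)).
  move: t_root; rewrite lamE => t_root.
  have -> : A y x = (A x x + A x y * t) * t - A y y * t by rewrite -t_root; ring.
  have -> : A y y = A x x + A x y * (t + s) by rewrite -sum_ts; ring.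
  ring.
have sum_gt0 : 0 < t + s by rewrite addr_gt0.
have prod_gt0 : 0 < t * s by rewrite mulr_gt0.
(* If [A x y] vanished, row [x] would force both values to equal [A x x]. *)
have [q_gt0|q_lt0|q0] := ltrgt0P (A x y).
- left; rewrite -subr_gt0 sum_ts prod_ts oppr_lt0.
  by split; apply: mulr_gt0.
- by right; rewrite -subr_lt0 sum_ts pmulr_llt0.
by move: lam_mu; rewrite lamE muE q0 !mul0r eqxx.
Qed.

(** A positive combination of two negative entries is negative, against the inequality for row [k]
    outside the support. *)
Lemma rich_pair_row (R : realType) (n : nat) (A : 'M[R]_n) (x y k : 'I_n) :
  x != y -> k != x -> k != y -> rich A [set x; y] ->
  A k x < 0 -> A k y < 0 -> False.
Proof.
move=> xy kx ky [lam [_ [_ /(produces_pair xy) + _]]].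
move=> [a [b [[a0 b0] _ _ /(_ k kx ky)]]] nneg kx0 ky0.
by move: nneg; apply/negP; rewrite -ltNge -oppr_gt0 opprD -!mulNr addr_gt0 ?mulr_gt0 ?oppr_gt0.
Qed.

Theorem theorem3p3 (R : realType) (n : nat) (hn : (3 <= n)%N) (A : 'M[R]_n) :
  triangle_free (G2 A).
Proof.
move=> [x [y [z [[xy yz xz] [[_ rxy] [_ ryz] [_ rxz]]]]]].
have [yx zy zx] : [/\ y != x, z != y & z != x] by split; rewrite eq_sym.
have [[xyd yx0]|[xyd xy0]] := rich_pair_sign xy rxy;
have [[yzd zy0]|[yzd yz0]] := rich_pair_sign yz ryz;
have [[xzd zx0]|[xzd xz0]] := rich_pair_sign xz rxz; try lra.
(* The two cyclic orderings of the diagonal entries are already refuted by [lra]. In the other six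
   cases the largest entry sits at [z], [x] or [y], and its row is tested against the opposite
   edge. *)
all: first [ exact: (rich_pair_row xy zx zy rxy)
           | exact: (rich_pair_row yz xy xz ryz)
           | exact: (rich_pair_row xz yx yz rxz) ].
Qed.
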